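(* Let $G=(G_1,\ldots,G_r)$ with $G_i\in\mathbb{R}[x_1,\ldots,x_n]$, let $S=\{x\in\mathbb{R}^n:G(x)=0\}$, and let $\bar x\in S$. Assume that $\operatorname{rank}DG(\bar x)=r$. Then $T_S(\bar x)=\operatorname{Ker}DG(\bar x)$, and for every $u\in T_S(\bar x)$, $$T^2_S(\bar x;u)=\{w\in\mathbb{R}^n:DG(\bar x)w+D^2G(\bar x)[u,u]=0\}.$$ Consequently, $S$ is parabolically regular at $\bar x$ in every tangent direction $u\in T_S(\bar x)$.
   Context: Bouligand tangent cone: $T_S(\bar x)=\{u\in\mathbb{R}^n:\exists t_k\downarrow 0,\ \exists u_k\to u \text{ with } \bar x+t_ku_k\in S\text{ for all }k\}$ ($t_k\downarrow0$ means $t_k>0$, $t_k\to0$). $T^2_S(\bar x;u)=T^{2,\mathrm{out}}_S(\bar x;u)$ is the outer parabolic second-order tangent set: all $w\in\mathbb{R}^n$ such that there exist $t_k\downarrow0$ and $w_k\to w$ with $\bar x+t_ku+\tfrac12t_k^2w_k\in S$ for all $k$. The inner parabolic tangent set $T^{2,\mathrm{in}}_S(\bar x;u)$ consists of all $w$ such that for every sequence $t_k\downarrow0$ there exist $w_k\to w$ with $\bar x+t_ku+\tfrac12t_k^2w_k\in S$ (membership being required for all sufficiently large $k$). $S$ is parabolically regular at $\bar x$ in direction $u$ if $T^{2,\mathrm{in}}_S(\bar x;u)=T^{2,\mathrm{out}}_S(\bar x;u)$. $DG(\bar x)$ is the Jacobian matrix and $D^2G(\bar x)[u,u]=(u^T\nabla^2G_1(\bar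 x)u,\ldots,u^T\nabla^2G_r(\bar x)u)$. *)

(* Defs.v *)
From HB Require Import structures.
From mathcomp Require Import all_boot all_order all_algebra.
From mathcomp Require Import all_classical all_reals all_analysis.
From mathcomp.multinomials Require mpoly.

Set Implicit Arguments.
Unset Strict Implicit.
Unset Printing Implicit Defensive.

Import Order.TTheory GRing.Theory Num.Theory.
Import numFieldNormedType.Exports.

Local Open Scope classical_set_scope.
Local Open Scope ring_scope.

(* [mpoly] is not imported: its notations clash with those of [all_analysis],
   hence the qualified names [mpoly.mpoly n R] for {mpoly R[n]}, [mpoly.meval]
   for _.@[_] and [mpoly.mderiv] for _^`M(_). *)

Section TangentSets.
Variables (R : realType) (n : nat).
Implicit Types (S : set 'cV[R]_n) (x u : 'cV[R]_n).

Definition to_zero_plus (t : R^nat) : Prop :=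
  (forall k, 0 < t k) /\ t @ \oo --> (0 : R).

Definition bouligand_cone S x : set 'cV[R]_n :=
  [set u | exists2 t : R^nat, to_zero_plus t &
           exists2 v : nat -> 'cV[R]_n, v @ \oo --> u &
           forall k, S (x + t k *: v k)].

Definition tangent2_out S x u : set 'cV[R]_n :=
  [set w | exists2 t : R^nat, to_zero_plus t &
           exists2 v : nat -> 'cV[R]_n, v @ \oo --> w &
           forall k, S (x + t k *: u + (2^-1 * t k ^+ 2) *: v k)].

Definition tangent2_in S x u : set 'cV[R]_n :=
  [set w | forall t : R^nat, to_zero_plus t ->
           exists2 v : nat -> 'cV[R]_n, v @ \oo --> w &
           \forall k \near \oo, S (x + t k *: u + (2^-1 * t k ^+ 2) *: v k)].

Definition parabolically_regular S x u : Prop :=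
  tangent2_in S x u = tangent2_out S x u.

End TangentSets.

Section PolynomialMaps.
Variables (R : realType) (n r : nat).
Implicit Types (p : mpoly.mpoly n R) (G : 'I_r -> mpoly.mpoly n R).
Implicit Types (x u : 'cV[R]_n).

Definition peval p x : R := mpoly.meval (fun j => x j 0) p.

Definition zero_set G : set 'cV[R]_n := [set x | forall i, peval (G i) x = 0].

Definition jac G x : 'M[R]_(r, n) :=
  \matrix_(i < r, j < n) peval (mpoly.mderiv j (G i)) x.

Definition hess p x : 'M[R]_n :=
  \matrix_(j < n, k < n) peval (mpoly.mderiv j (mpoly.mderiv k p)) x.

Definition second_diff G x u : 'cV[R]_r :=
  \col_(i < r) (u^T *m hess (G i) x *m u) 0 0.

End PolynomialMaps.

(* Main.v *)
Require Import Defs.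
From HB Require Import structures.
From mathcomp Require Import all_boot all_order all_algebra.
From mathcomp Require Import all_classical all_reals all_analysis.
From mathcomp.multinomials Require Import -(notations) mpoly.
From mathcomp Require Import ring lra.

Set Implicit Arguments.
Unset Strict Implicit.
Unset Printing Implicit Defensive.

Import Order.TTheory GRing.Theory Num.Theory.
Import numFieldNormedType.Exports.

Local Open Scope classical_set_scope.
Local Open Scope ring_scope.

(** Write [A] for the Jacobian of [G] at [x]. The theorem is a chain of four
    inclusions for [u] in the kernel of [A],

      [T2in <= T2out <= {w | A w + D2G[u,u] = 0} <= T2in],

    together with two facts on the tangent cone.

    The second inclusion is Taylor's formula along parabolic arcs: if [t -> 0]
    and [v -> w] then [G (x + t u + t^2/2 v) = G x + t A u + t^2/2 e] with
    [e -> A w + D2G[u,u]] ([pmap_expansion2]). No remainder estimate is needed: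
    sequences admitting such an expansion are closed under sums and products,
    and polynomials are generated by constants and coordinates.

    The third inclusion is where the rank hypothesis enters. The same formula
    says that the arc [x + t u + t^2/2 w] misses the zero set only by an error
    [G = t^2/2 e] with [e -> 0]. Let [B] be a right inverse of [A]. A
    Lyusternik-Graves correction ([local_correction]) moves any point [y] near
    [x] onto the zero set by adding [B z] with [|z| <= 2 |G y|]; applied to the
    arc it adds [t^2/2 w'] with [w' -> 0], which is what [T2in] asks. The
    correction is a fixed point of [z |-> z - G (y + B z)]; this map is a
    contraction because [G a - G b = M (a, b) (a - b)] for some continuous [M]
    with [M (x, x) = A] ([pmap_hadamard]), so that its increments are governed
    by [1 - M B], which is small near [x].

    For the tangent cone, the factorisation through [M] gives
    [M (x + t v, x) v = 0] along a tangent sequence, hence [A u = 0] in the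
    limit. Conversely, for [u] in the kernel the affine space
    [{w | A w + D2G[u,u] = 0}] contains [- B D2G[u,u]], so a parabolic arc in
    the zero set leaves [x] with velocity [u]. *)

(** * Matrices with the sup norm *)

(** Joins the completeness and the norm of matrix spaces, so that Banach's fixed
    point theorem applies to them. *)
HB.instance Definition _ (R : realType) m n :=
  Uniform_isComplete.Build 'M[R]_(m, n) cauchy_cvg.

Section MatrixNorm.
Variable R : realType.

Lemma normr_mx_entry m n (A : 'M[R]_(m, n)) i j : `|A i j| <= `|A|.
Proof.
rewrite [leRHS]/Num.norm /= mx_normrE; apply/bigmax_geP; right => /=.
by exists (i, j).
Qed.

Lemma normr_mx_le m n (A : 'M[R]_(m, n)) c :
  0 <= c -> (forall i j, `|A i j| <= c) -> `|A| <= c.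
Proof.
move=> c0 Ac; rewrite /Num.norm /= mx_normrE; apply/bigmax_leP.
by split=> // -[i j] _ /=.
Qed.

Lemma normr_mulmx m n p (A : 'M[R]_(m, n)) (B : 'M[R]_(n, p)) :
  `|A *m B| <= n%:R * `|A| * `|B|.
Proof.
apply: normr_mx_le => [|i j]; first by rewrite !mulr_ge0.
rewrite mxE (le_trans (ler_norm_sum _ _ _))//.
rewrite (@le_trans _ _ (\sum_(k < n) `|A| * `|B|))//.
  by apply: ler_sum => k _; rewrite normrM ler_pM// normr_mx_entry.
by rewrite sumr_const card_ord -[leLHS]mulr_natl mulrA.
Qed.

Lemma cvg_mxP (T : Type) (F : set_system T) {FF : Filter F} m n
    (f : T -> 'M[R]_(m, n)) (A : 'M[R]_(m, n)) :
  f @ F --> A <-> forall i j, f x i j @[x --> F] --> A i j.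
Proof.
split=> [fA i j|fA].
  exact: (cvg_comp _ _ fA (@coord_continuous R m n i j A)).
apply/cvgrPdist_le => e e0.
have : \forall x \near F, forall ij : 'I_m * 'I_n,
    `|A ij.1 ij.2 - f x ij.1 ij.2| <= e.
  apply: filter_forall => -[i j] /=.
  by have /cvgrPdist_le := fA i j; apply.
apply: filterS => x fx; apply: normr_mx_le => [|i j]; first exact: ltW.
by rewrite !mxE; exact: (fx (i, j)).
Qed.

Lemma cvg_sumr (T : Type) (F : set_system T) {FF : Filter F} n
    (f : 'I_n -> T -> R) (l : 'I_n -> R) :
  (forall i, f i @ F --> l i) ->
  \sum_(i < n) f i x @[x --> F] --> \sum_(i < n) l i.
Proof. by move=> fl; apply: cvg_big => //; exact: add_continuous. Qed.

Lemma cvg_mulmx (T : Type) (F : set_system T) {FF : Filter F} m n p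
    (f : T -> 'M[R]_(m, n)) (g : T -> 'M[R]_(n, p))
    (A : 'M[R]_(m, n)) (B : 'M[R]_(n, p)) :
  f @ F --> A -> g @ F --> B -> (f x *m g x) @[x --> F] --> A *m B.
Proof.
move=> /cvg_mxP fA /cvg_mxP gB; apply/cvg_mxP => i j.
under eq_fun do rewrite mxE; rewrite mxE.
by apply: cvg_sumr => k; apply: cvgM.
Qed.

End MatrixNorm.

(** * Evaluation of polynomials *)

Section PolynomialEvaluation.
Variables (R : realType) (n : nat).
Implicit Types (p q : mpoly n R) (x : 'cV[R]_n).

(** Both [hadamard] and [expansion2_peval] assert that some class of functions
    closed under ring operations contains all polynomials. *)
Lemma mpoly_ring_ind (P : mpoly n R -> Prop) :
  (forall c, P (mpolyC n c)) -> (forall i, P (mpolyX R (mnm1 i))) ->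
  (forall p q, P p -> P q -> P (p + q)) ->
  (forall p q, P p -> P q -> P (p * q)) -> forall p, P p.
Proof.
move=> PC PX PD PM; elim/mpolyind => [|c m p _ _ Pp].
  by rewrite -mpolyC0.
apply: PD Pp; rewrite -mul_mpolyC; apply: (PM) => //.
rewrite mpolyXE_id; elim/big_ind: _ => [|p1 p2 P1 P2|i _].
- by rewrite -mpolyC1.
- exact: PM.
- elim: (m i) => [|k IH]; first by rewrite expr0 -mpolyC1.
  by rewrite exprS; exact: PM.
Qed.

Lemma pevalC c x : peval (mpolyC n c) x = c. Proof. exact: mevalC. Qed.

Lemma pevalX i x : peval (mpolyX R (mnm1 i)) x = x i 0.
Proof. exact: mevalXU. Qed.

Lemma pevalD p q x : peval (p + q) x = peval p x + peval q x.
Proof. exact: mevalD. Qed.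

Lemma pevalM p q x : peval (p * q) x = peval p x * peval q x.
Proof. exact: mevalM. Qed.

Lemma pevalZ c p x : peval (c *: p) x = c * peval p x.
Proof. exact: mevalZ. Qed.

Lemma peval_sum (I : Type) (s : seq I) (F : I -> mpoly n R) x :
  peval (\sum_(i <- s) F i) x = \sum_(i <- s) peval (F i) x.
Proof. exact: raddf_sum. Qed.

Lemma mderivU (i j : 'I_n) :
  mderiv j (mpolyX R (mnm1 i)) = mpolyC n (i == j)%:R.
Proof.
rewrite mderivX mnm1E; case: eqP => [->|_]; last by rewrite scale0r mpolyC0.
rewrite scale1r; transitivity (mpolyX R (mnm0 : multinom n)).
  congr (mpolyX R _); by apply/mnmP => k; rewrite !mnmE subnn.
exact: mpolyX0.
Qed.

Lemma cvg_peval p (T : Type) (F : set_system T) {FF : Filter F}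
    (f : T -> 'cV[R]_n) x :
  f @ F --> x -> peval p (f t) @[t --> F] --> peval p x.
Proof.
move=> fx; elim/mpoly_ring_ind: p => [c|i|p q Pp Pq|p q Pp Pq].
- by under eq_fun do rewrite pevalC; rewrite pevalC; exact: cvg_cst.
- under eq_fun do rewrite pevalX; rewrite pevalX.
  by have /cvg_mxP := fx; apply.
- by under eq_fun do rewrite pevalD; rewrite pevalD; exact: cvgD.
- by under eq_fun do rewrite pevalM; rewrite pevalM; exact: cvgM.
Qed.

(** A two-point form of the mean value theorem, exact and with continuous
    coefficients. It holds for products because
    [p a q a - p b q b = (p a - p b) q a + p b (q a - q b)], and this identity
    turns into Leibniz' rule when [a = b]. *)
Lemma hadamard p : exists g : 'I_n -> 'cV[R]_n * 'cV[R]_n -> R,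
  [/\ forall a b, peval p a - peval p b =
        \sum_(j < n) g j (a, b) * (a j 0 - b j 0),
      forall j a, g j (a, a) = peval (mderiv j p) a &
      forall j, continuous (g j)].
Proof.
elim/mpoly_ring_ind: p => [c|i|p q [g [gE gd gc]] [h [hE hd hc]]|
                           p q [g [gE gd gc]] [h [hE hd hc]]].
- exists (fun _ _ => 0); split=> [a b|j a|j].
  + by rewrite !pevalC subrr big1// => j _; rewrite mul0r.
  + by rewrite mderivC -mpolyC0 pevalC.
  + exact: cst_continuous.
- exists (fun j _ => (i == j)%:R); split=> [a b|j a|j].
  + rewrite !pevalX (bigD1 i)//= eqxx mul1r big1 ?addr0// => j.
    by rewrite eq_sym => /negbTE ->; rewrite mul0r.
  + by rewrite mderivU pevalC.
  + exact: cst_continuous.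
- exists (fun j ab => g j ab + h j ab); split=> [a b|j a|j].
  + under eq_bigr do rewrite mulrDl.
    by rewrite big_split/= -gE -hE !pevalD; ring.
  + by rewrite gd hd mderivD pevalD.
  + by move=> ab; apply: continuousD; [exact: gc|exact: hc].
- exists (fun j ab => g j ab * peval q ab.1 + peval p ab.2 * h j ab).
  split=> [a b|j a|j].
  + under eq_bigr do rewrite mulrDl mulrAC /=.
    rewrite big_split/= -mulr_suml -gE.
    under eq_bigr do rewrite -mulrA.
    by rewrite -mulr_sumr -hE !pevalM; ring.
  + by rewrite gd hd mderivM pevalD !pevalM.
  + move=> ab; apply: cvgD; apply: cvgM; [exact: gc| | |exact: hc].
      by apply: cvg_peval; exact: cvg_fst.
    by apply: cvg_peval; exact: cvg_snd.
Qed.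

End PolynomialEvaluation.

(** * Second-order expansions along parabolic arcs *)

Section SecondOrderExpansion.
Variable R : realType.
Implicit Types (t a b : R^nat) (c : R).

(** The quotient [2 (a - a0 - t a1) / t^2] converges to [a2]: the sequence [a]
    behaves like a curve with value [a0], velocity [a1] and acceleration [a2]
    at time [0], sampled at the times [t]. Stating it through [e] avoids
    dividing by [t]. *)
Definition expansion2 (t a : R^nat) (a0 a1 a2 : R) := exists2 e : R^nat,
  e @ \oo --> a2 & forall k, a k = a0 + t k * a1 + 2^-1 * t k ^+ 2 * e k.

Lemma expansion2_cst t c : expansion2 t (fun=> c) c 0 0.
Proof.
by exists (fun=> 0) => [|k]; [exact: cvg_cst|rewrite !mulr0 !addr0].
Qed.

Lemma expansion2D t a b (a0 a1 a2 b0 b1 b2 : R) :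
  expansion2 t a a0 a1 a2 -> expansion2 t b b0 b1 b2 ->
  expansion2 t (fun k => a k + b k) (a0 + b0) (a1 + b1) (a2 + b2).
Proof.
move=> [e ea aE] [f fb bE]; exists (fun k => e k + f k); first exact: cvgD.
by move=> k; rewrite aE bE; ring.
Qed.

(** The coefficients are those of Leibniz' rule up to order two; the
    coefficient of [t^2/2] in the product is collected with all the terms of
    higher order in [t], which vanish in the limit. *)
Lemma expansion2M t a b (a0 a1 a2 b0 b1 b2 : R) : t @ \oo --> (0 : R) ->
  expansion2 t a a0 a1 a2 -> expansion2 t b b0 b1 b2 ->
  expansion2 t (fun k => a k * b k)
    (a0 * b0) (a1 * b0 + a0 * b1) (a2 * b0 + 2 * (a1 * b1) + a0 * b2).
Proof.
move=> t0 [e ea aE] [f fb bE].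
exists (fun k => e k * b0 + 2 * (a1 * b1) + a0 * f k +
  (t k * (e k * b1 + a1 * f k) + 2^-1 * t k ^+ 2 * (e k * f k))).
  rewrite -[X in _ --> X]addr0.
  have -> : 0 = 0 * (a2 * b1 + a1 * b2) + 2^-1 * (0 * 0) * (a2 * b2) :> R.
    by rewrite !mul0r !mulr0 mul0r addr0.
  apply: cvgD; apply: cvgD.
  - apply: cvgD; last exact: cvg_cst.
    by apply: cvgM => //; exact: cvg_cst.
  - by apply: cvgM => //; exact: cvg_cst.
  - by apply: cvgM => //; apply: cvgD; apply: cvgM => //; exact: cvg_cst.
  - apply: cvgM; apply: cvgM => //; first exact: cvg_cst.
    by under eq_fun do rewrite expr2; exact: cvgM.
by move=> k; rewrite aE bE; field.
Qed.

Variable n : nat.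
Implicit Types (p q : mpoly n R) (x u w : 'cV[R]_n).

(** The derivative in direction [u], as a polynomial rather than a number, so
    that it can be iterated and second derivatives obey Leibniz' rule. *)
Definition dirderiv u p : mpoly n R := \sum_(j < n) u j 0 *: mderiv j p.

Lemma dirderivC u c : dirderiv u (mpolyC n c) = 0.
Proof. by rewrite /dirderiv big1// => j _; rewrite mderivC scaler0. Qed.

Lemma dirderivX u i : dirderiv u (mpolyX R (mnm1 i)) = mpolyC n (u i 0).
Proof.
rewrite /dirderiv (bigD1 i)//= big1 => [|j]; rewrite mderivU.
  by rewrite eqxx addr0 -mul_mpolyC -mpolyCM mulr1.
by rewrite eq_sym => /negbTE ->; rewrite mpolyC0 scaler0.
Qed.

Lemma dirderivD u p q : dirderiv u (p + q) = dirderiv u p + dirderiv u q.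
Proof.
by rewrite -big_split/=; apply: eq_bigr => j _; rewrite mderivD scalerDr.
Qed.

Lemma dirderivM u p q :
  dirderiv u (p * q) = dirderiv u p * q + p * dirderiv u q.
Proof.
rewrite mulr_suml mulr_sumr -big_split/=; apply: eq_bigr => j _.
by rewrite mderivM scalerDr scalerAl scalerAr.
Qed.

(** The acceleration of [p] along an arc with velocity [u] and acceleration [w]
    has a part linear in [w] and a part quadratic in [u]; for a product, the
    cross term [2 (D_u p) (D_u q)] comes from the quadratic part. *)
Lemma expansion2_peval p x u w t (v : nat -> 'cV[R]_n) :
  t @ \oo --> (0 : R) -> v @ \oo --> w ->
  expansion2 t (fun k => peval p (x + t k *: u + (2^-1 * t k ^+ 2) *: v k))
    (peval p x) (peval (dirderiv u p) x)
    (peval (dirderiv w p) x + peval (dirderiv u (dirderiv u p)) x).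
Proof.
move=> t0 vw; elim/mpoly_ring_ind: p => [c|i|p q IHp IHq|p q IHp IHq].
- rewrite !dirderivC -mpolyC0 !pevalC addr0.
  by under eq_fun do rewrite pevalC; exact: expansion2_cst.
- rewrite !dirderivX dirderivC -mpolyC0 !pevalC pevalX addr0.
  exists (fun k => v k i 0); first by have /cvg_mxP := vw; apply.
  by move=> k; rewrite pevalX !mxE.
- under eq_fun do rewrite pevalD.
  by rewrite !dirderivD !pevalD addrACA; exact: expansion2D.
- under eq_fun do rewrite pevalM.
  have := expansion2M t0 IHp IHq.
  rewrite !dirderivM !dirderivD !dirderivM !pevalD !pevalM.
  by congr expansion2; ring.
Qed.

Variable r : nat.
Implicit Types G : 'I_r -> mpoly n R.

Definition pmap G x : 'cV[R]_r := \col_i peval (G i) x.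

Lemma zero_setE G x : zero_set G x <-> pmap G x = 0.
Proof.
split=> [Gx|/colP Gx i]; first by apply/colP => i; rewrite !mxE Gx.
by have := Gx i; rewrite !mxE.
Qed.

Lemma jac_mulE G x u i : (jac G x *m u) i 0 = peval (dirderiv u (G i)) x.
Proof.
rewrite mxE peval_sum; apply: eq_bigr => j _.
by rewrite mxE pevalZ mulrC.
Qed.

Lemma second_diffE G x u i :
  second_diff G x u i 0 = peval (dirderiv u (dirderiv u (G i))) x.
Proof.
(* In the matrix product the outer sum runs over the index of the derivative
   that is taken first; in the iterated [dirderiv] it is the inner one. *)
rewrite mxE mxE peval_sum /=.
under eq_bigr do rewrite mxE mulr_suml.
rewrite exchange_big/=; apply: eq_bigr => j _.
rewrite pevalZ /dirderiv linear_sum peval_sum mulr_sumr.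
apply: eq_bigr => k _ /=; rewrite mderivZ pevalZ !mxE; ring.
Qed.

Lemma pmap_expansion2 G x u w t (v : nat -> 'cV[R]_n) :
  t @ \oo --> (0 : R) -> v @ \oo --> w ->
  exists2 e : nat -> 'cV[R]_r,
    e @ \oo --> jac G x *m w + second_diff G x u &
    forall k, pmap G (x + t k *: u + (2^-1 * t k ^+ 2) *: v k) =
      pmap G x + t k *: (jac G x *m u) + (2^-1 * t k ^+ 2) *: e k.
Proof.
move=> t0 vw.
have /choice[e eP] : forall i : 'I_r, exists e : R^nat,
    e @ \oo --> (jac G x *m w + second_diff G x u) i 0 /\
    forall k, peval (G i) (x + t k *: u + (2^-1 * t k ^+ 2) *: v k) =
      peval (G i) x + t k * (jac G x *m u) i 0 + 2^-1 * t k ^+ 2 * e k.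
  move=> i; have [e eE Ge] := expansion2_peval (G i) x u t0 vw.
  exists e; split=> [|k]; last by rewrite jac_mulE.
  by rewrite [X in _ --> X]mxE jac_mulE second_diffE.
exists (fun k => \col_i e i k).
  apply/cvg_mxP => i j; rewrite ord1.
  by under eq_fun do rewrite mxE; exact: (eP i).1.
move=> k; apply/colP => i; rewrite mxE (eP i).2.
by rewrite [RHS]mxE [X in _ = X + _]mxE !mxE.
Qed.

End SecondOrderExpansion.

(** * Solving the equations near a regular point *)

(** A map that contracts distances by half on a ball sends this ball into itself
    as soon as it moves the centre by at most half the radius. *)
Lemma ball_fixed_point (R : realType) (X : completeNormedModType R)
    (f : X -> X) (s : R) :
  (forall y z, `|y| <= s -> `|z| <= s -> `|f y - f z| <= 2^-1 * `|y - z|) ->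
  `|f 0| <= 2^-1 * s -> exists2 z, `|z| <= s & f z = z.
Proof.
move=> fC f0; set K : set X := [set z | `|z| <= s].
have s0 : 0 <= s.
  by rewrite -(pmulr_rge0 _ (_ : 0 < 2^-1 :> R)) ?(le_trans _ f0).
have K0 : K 0 by rewrite /K/= normr0.
have fK : set_fun K K f.
  move=> z Kz; rewrite /K/= -(subrK (f 0) (f z)) (le_trans (ler_normD _ _))//.
  have := fC z 0 Kz K0; rewrite subr0 => fz.
  by have := Kz; rewrite /K/=; lra.
have Kcl : closed K.
  have -> : K = (fun z : X => `|z|) @^-1` [set y | y <= s] by [].
  apply: (@preimage_closed X R Num.norm); last exact: closed_le.
  by move=> z _; exact: norm_continuous.
pose fF := isFun.Build X X K K f fK.
pose F : {fun K >-> K} := HB.pack f fF.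
have ctr : is_contraction F.
  exists (2^-1)%:nng; split=> /=; first by rewrite invf_lt1// ltr1n.
  by move=> [y z] [/= Ky Kz]; exact: fC.
have [z Kz zE] := banach_fixed_point ctr Kcl (ex_intro _ 0 K0).
by exists z.
Qed.

Section LocalSolvability.
Variables (R : realType) (n r : nat).
Implicit Types (G : 'I_r -> mpoly n R) (x y a b : 'cV[R]_n).

Lemma pmap_hadamard G : exists M : 'cV[R]_n * 'cV[R]_n -> 'M[R]_(r, n),
  [/\ forall a b, pmap G a - pmap G b = M (a, b) *m (a - b),
      forall a, M (a, a) = jac G a & continuous M].
Proof.
have /choice[g gP] := fun i => hadamard (G i).
exists (fun ab => \matrix_(i, j) g i j ab); split=> [a b|a|ab].
- apply/colP => i; have [gE _ _] := gP i.
  by rewrite !mxE gE; apply: eq_bigr => j _; rewrite !mxE.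
- by apply/matrixP => i j; have [_ gd _] := gP i; rewrite !mxE gd.
- apply/cvg_mxP => i j; have [_ _ gc] := gP i.
  by under eq_fun do rewrite mxE; rewrite mxE; exact: gc.
Qed.

(** The correction [z] costs no more than a multiple of the residual [G y]; this
    linear bound keeps corrections of order [o(t^2)] for residuals of that
    order. It is a fixed point of the simplified Newton map
    [z |-> z - G (y + B z)] on the ball of radius [2 |G y|]. *)
Lemma local_correction G x : \rank (jac G x) = r ->
  exists2 B : 'M[R]_(n, r), jac G x *m B = 1%:M &
  exists2 rho : R, 0 < rho & forall y, `|y - x| <= rho -> `|pmap G y| <= rho ->
  exists2 z : 'cV[R]_r, `|z| <= 2 * `|pmap G y| & pmap G (y + B *m z) = 0.
Proof.
move=> rkA; have freeA : row_free (jac G x) by rewrite /row_free rkA.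
exists (pinvmx (jac G x)); first exact: mulmxVp.
set B := pinvmx _; have [M [ME Md Mc]] := pmap_hadamard G.
(* [r * c <= 1/2]; the factor [r] is the loss in the sup norm of a product. *)
pose c : R := (2 * (1 + r%:R))^-1.
have r0 : 0 <= r%:R :> R by [].
have c0 : 0 < c by rewrite /c invr_gt0; lra.
have [d d0 MB] : exists2 d : R, 0 < d &
    forall a b, `|a - x| < d -> `|b - x| < d -> `|1%:M - M (a, b) *m B| <= c.
  have : (fun ab => M ab *m B) @ (x, x) --> (1%:M : 'M[R]_r).
    have -> : 1%:M = M (x, x) *m B by rewrite Md mulmxVp.
    apply: cvg_mulmx; first exact: Mc.
    exact: cvg_cst.
  move=> /cvgrPdist_le /(_ _ c0) [[U V] /= [/nbhs_normP[e e0 eU]]].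
  move=> /nbhs_normP[f f0 fV] UV.
  exists (Num.min e f); first by rewrite lt_min; apply/andP; split.
  move=> a b; rewrite !lt_min => /andP[ae _] /andP[_ bf].
  by apply: (UV (a, b)); split; [apply: eU|apply: fV]; rewrite /= distrC.
(* With [|B z| <= K |z| <= 2 K rho], this radius keeps [y + B z] within [d / 2]
   of [x]. *)
have K0 : 0 <= r%:R * `|B| by rewrite mulr_ge0.
set K := r%:R * `|B| in K0.
exists (d / (2 * (1 + 2 * K))); first by rewrite divr_gt0//; lra.
set rho := d / _ => y yx Gy.
have rhoE : rho * (2 * (1 + 2 * K)) = d by rewrite /rho; field; apply/eqP; lra.
have rho0 : 0 < rho by rewrite divr_gt0//; lra.
have near_x z : `|z| <= 2 * `|pmap G y| -> `|y + B *m z - x| < d.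
  move=> zs; rewrite addrAC (le_lt_trans (ler_normD _ _))//.
  have := normr_mulmx B z; rewrite -/K => Bz.
  have : K * `|z| <= K * (2 * rho) by apply: ler_wpM2l => //; lra.
  by nra.
pose Phi (z : 'cV[R]_r) := z - pmap G (y + B *m z).
have [z1 z2 z1s z2s| |z zs zE] :=
    @ball_fixed_point R 'cV[R]_r Phi (2 * `|pmap G y|).
- have -> : Phi z1 - Phi z2 =
      (1%:M - M (y + B *m z1, y + B *m z2) *m B) *m (z1 - z2).
    have yE : y + B *m z1 - (y + B *m z2) = B *m (z1 - z2).
      by rewrite mulmxBr opprD addrACA subrr add0r.
    by rewrite mulmxBl mul1mx -mulmxA -yE -ME /Phi !opprD addrACA.
  apply: (le_trans (normr_mulmx _ _)).
  rewrite ler_wpM2r//.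
  rewrite (@le_trans _ _ (r%:R * c))//.
    by apply: ler_wpM2l => //; apply: MB; exact: near_x.
  by rewrite /c ler_pdivrMr; lra.
- by rewrite /Phi mulmx0 addr0 sub0r normrN mulKf.
exists z => //; move: zE; rewrite /Phi => /eqP.
by rewrite subr_eq addrC -subr_eq subrr eq_sym => /eqP.
Qed.

End LocalSolvability.

(** * Tangent sets *)

Section TangentSetsOfZeroSet.
Variables (R : realType) (n : nat).
Implicit Types (S : set 'cV[R]_n) (x u w : 'cV[R]_n).

Lemma to_zero_plus_harmonic : to_zero_plus (@harmonic R).
Proof. by split=> [k|]; [exact: harmonic_gt0|exact: cvg_harmonic]. Qed.

(** The inner set quantifies over all time sequences, so it suffices to have
    one; the finitely many times at which membership may fail are dropped. *)
Lemma tangent2_in_sub_out S x u : tangent2_in S x u `<=` tangent2_out S x u.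
Proof.
move=> w /(_ _ to_zero_plus_harmonic)[v vw [N _ NS]].
exists (fun k => harmonic (k + N)%N).
  split=> [k|]; first exact: harmonic_gt0.
  by rewrite (cvg_shiftn N); exact: cvg_harmonic.
exists (fun k => v (k + N)%N); first by rewrite (cvg_shiftn N).
by move=> k; apply: NS; rewrite /= leq_addl.
Qed.

(** A parabolic arc is a first-order arc with velocities [u + t/2 v -> u]. *)
Lemma tangent2_out_bouligand S x u w :
  tangent2_out S x u w -> bouligand_cone S x u.
Proof.
move=> [t t0 [v vw vS]]; exists t => //.
exists (fun k => u + (2^-1 * t k) *: v k); last first.
  by move=> k; rewrite scalerDr scalerA addrA mulrCA -expr2.
rewrite -[X in _ --> X]addr0 -(scale0r w) -(mulr0 2^-1).
apply: cvgD; first exact: cvg_cst.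
by apply: cvgZ => //; apply: cvgM; [exact: cvg_cst|exact: t0.2].
Qed.

Variable r : nat.
Implicit Types G : 'I_r -> mpoly n R.

(** Divide [0 = G (x + t v) - G x = M (x + t v, x) (t v)] by [t] and pass to the
    limit. *)
Lemma bouligand_cone_sub_ker G x u : zero_set G x ->
  bouligand_cone (zero_set G) x u -> jac G x *m u = 0.
Proof.
move=> /zero_setE Gx [t [tpos t0] [v vu vS]].
have [M [ME Md Mc]] := pmap_hadamard G.
have xv : (x + t k *: v k) @[k --> \oo] --> x.
  rewrite -[X in _ --> X]addr0 -(scale0r u).
  by apply: cvgD; [exact: cvg_cst|exact: cvgZ].
have : M (x + t k *: v k, x) *m v k @[k --> \oo] --> jac G x *m u.
  apply: cvg_mulmx => //; rewrite -Md.
  apply: (@cvg_comp _ _ _ _ M _ (nbhs (x, x))) (Mc (x, x)).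
  exact: (cvg_pair xv (cvg_cst x)).
have -> : (fun k => M (x + t k *: v k, x) *m v k) = (fun=> 0).
  apply/funext => k; apply: (@scalerI _ _ (t k)); first by rewrite gt_eqF.
  have /zero_setE Gk := vS k.
  have := ME (x + t k *: v k) x.
  by rewrite Gk Gx subrr [X in _ *m X]addrAC subrr add0r scaler0 scalemxAr.
move=> A0; exact: (cvg_unique (@norm_hausdorff R 'cV[R]_r) A0 (cvg_cst 0)).
Qed.

(** With [G x = 0] and [A u = 0], only the term of order [t^2] of the expansion
    is left; it vanishes along the sequence, hence so does its limit. *)
Lemma tangent2_out_sub G x u w : zero_set G x -> jac G x *m u = 0 ->
  tangent2_out (zero_set G) x u w ->
  jac G x *m w + second_diff G x u = 0.
Proof.
move=> /zero_setE Gx Au [t [tpos t0] [v vw vS]].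
have [e el eE] := pmap_expansion2 G x u t0 vw.
have e0 : e = (fun=> 0).
  apply/funext => k; have /zero_setE := vS k.
  rewrite eE Gx Au scaler0 !add0r => /eqP.
  rewrite scaler_eq0 mulf_eq0 expf_eq0 invr_eq0 pnatr_eq0 /= gt_eqF//=.
  by move/eqP.
rewrite e0 in el.
exact: (cvg_unique (@norm_hausdorff R 'cV[R]_r) el (cvg_cst 0)).
Qed.

(** The arc with constant acceleration [w] has residual [G = t^2/2 e] with
    [e -> 0]; correcting it by [B z] amounts to adding [2 B z / t^2] to the
    acceleration, a quantity of size at most a multiple of [|e|]. *)
Lemma sub_tangent2_in G x u w : zero_set G x -> \rank (jac G x) = r ->
  jac G x *m u = 0 -> jac G x *m w + second_diff G x u = 0 ->
  tangent2_in (zero_set G) x u w.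
Proof.
move=> /zero_setE Gx rkA Au Aw t [tpos t0].
have [B _ [rho rho0 corr]] := local_correction rkA.
have [e] := pmap_expansion2 G x u t0 (cvg_cst w).
rewrite Aw Gx Au => e0 eE.
pose h k := 2^-1 * t k ^+ 2.
have h0 k : 0 < h k by rewrite mulr_gt0 ?exprn_gt0// invr_gt0.
pose y k := x + t k *: u + h k *: w.
have yE k : pmap G (y k) = h k *: e k.
  by rewrite eE scaler0 !add0r.
have hto0 : h @ \oo --> (0 : R).
  rewrite -(mulr0 2^-1) -[X in _ * X](mulr0 0).
  apply: cvgM; first exact: cvg_cst.
  by under eq_fun do rewrite expr2; exact: cvgM.
have yx : y @ \oo --> x.
  rewrite -[X in _ --> X]addr0 -(scale0r w) -[X in X + _]addr0 -(scale0r u).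
  by apply: cvgD; [apply: cvgD; [|apply: cvgZ]|apply: cvgZ] => //;
     exact: cvg_cst.
have Gy : (pmap G (y k)) @[k --> \oo] --> (0 : 'cV[R]_r).
  under eq_fun do rewrite yE.
  by rewrite -(scale0r 0); apply: cvgZ.
(* Far from the limit the correction need not exist, and any value of [z] will
   do. *)
have /choice[z zP] : forall k, exists z : 'cV[R]_r,
    `|y k - x| <= rho -> `|pmap G (y k)| <= rho ->
    `|z| <= 2 * `|pmap G (y k)| /\ pmap G (y k + B *m z) = 0.
  move=> k.
  have [yk|yk] := pselect (`|y k - x| <= rho /\ `|pmap G (y k)| <= rho).
    by have [z zs zE] := corr (y k) yk.1 yk.2; exists z.
  by exists 0 => y1 y2; case: yk.
have ok : \forall k \near \oo,
    `|z k| <= 2 * `|pmap G (y k)| /\ pmap G (y k + B *m z k) = 0.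
  near=> k; apply: zP; near: k.
    by have /cvgrPdist_le/(_ _ rho0) := yx; apply: filterS => k; rewrite distrC.
  have /cvgrPdist_le/(_ _ rho0) := Gy.
  by apply: filterS => k; rewrite sub0r normrN.
exists (fun k => w + B *m ((h k)^-1 *: z k)).
  rewrite -[X in _ --> X]addr0 -(mulmx0 _ B).
  apply: cvgD; first exact: cvg_cst.
  apply: cvg_mulmx; first exact: cvg_cst.
  apply/cvgr0Pnorm_le => eps eps0.
  have eps2 : 0 < eps / 2 by rewrite divr_gt0.
  have /cvgr0Pnorm_le /(_ _ eps2) small := e0.
  near=> k.
  have [zk _] : `|z k| <= 2 * `|pmap G (y k)| /\ pmap G (y k + B *m z k) = 0.
    by near: k.
  have ek : `|e k| <= eps / 2 by near: k.
  rewrite normrZ gtr0_norm ?invr_gt0// ler_pdivrMl//.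
  apply: (le_trans zk); rewrite yE normrZ gtr0_norm//.
  by rewrite mulrCA ler_pM2l//; lra.
apply: filterS ok => k [_ zE]; apply/zero_setE.
rewrite -[RHS]zE /y scalerDr addrA -scalemxAr scalerA -/(h k) mulfV ?gt_eqF//.
by rewrite scale1r.
Unshelve. all: by end_near. Qed.

End TangentSetsOfZeroSet.

Theorem theorem3p5 (R : realType) (n r : nat)
    (G : 'I_r -> mpoly.mpoly n R) (xbar : 'cV[R]_n) :
  zero_set G xbar ->
  \rank (jac G xbar) = r ->
  [/\ bouligand_cone (zero_set G) xbar =
        [set u : 'cV[R]_n | jac G xbar *m u = 0],
      (forall u : 'cV[R]_n, bouligand_cone (zero_set G) xbar u ->
         tangent2_out (zero_set G) xbar u =
           [set w : 'cV[R]_n |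
             jac G xbar *m w + second_diff G xbar u = 0]) &
      (forall u : 'cV[R]_n, bouligand_cone (zero_set G) xbar u ->
         parabolically_regular (zero_set G) xbar u)].
Proof.
move=> Gx rkA; split=> [|u Tu|u Tu].
- apply/seteqP; split=> u; first exact: bouligand_cone_sub_ker.
  move=> /= Au; have [B AB _] := local_correction rkA.
  apply: (@tangent2_out_bouligand _ _ _ _ _ (- (B *m second_diff G xbar u))).
  apply/tangent2_in_sub_out/sub_tangent2_in => //.
  by rewrite mulmxN mulmxA AB mul1mx addNr.
- have Au := bouligand_cone_sub_ker Gx Tu.
  apply/seteqP; split=> w; first exact: tangent2_out_sub.
  by move=> /= Aw; apply/tangent2_in_sub_out/sub_tangent2_in.
- have Au := bouligand_cone_sub_ker Gx Tu.
  apply/seteqP; split=> w; first exact: tangent2_in_sub_out.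
  by move=> /(tangent2_out_sub Gx Au); exact: sub_tangent2_in.
Qed.
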